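(* A finitely generated $\mathbb{Z}$-module is weakly-morphic if and only if it is finite.
   Context: A $\mathbb{Z}$-module $M$ is weakly-morphic if $M/Ma\cong \{m\in M: ma=0\}$ as $\mathbb{Z}$-modules for every $a\in\mathbb{Z}$, where $Ma=\{ma: m\in M\}$. *)

(* Defs.v *)
From HB Require Import structures.
From mathcomp Require Import all_boot all_order all_algebra.
From mathcomp Require Import boolp classical_sets functions cardinality.

Set Implicit Arguments.
Unset Strict Implicit.
Unset Printing Implicit Defensive.

Import GRing.Theory.
Local Open Scope ring_scope.
Local Open Scope quotient_scope.

(* MathComp provides the quotient of an additive group by a subgroup; the
   induced scalar action is added here. *)
Section QuotientModule.
Variables (R : pzRingType) (V : lmodType R) (N : submodClosed V).

(* [submodClosed] does not record closure under opposite, which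
   [Quotient.quot] requires. *)
Definition submod_pred : {pred V} := fun x => x \in N.
HB.instance Definition _ := GRing.isZmodClosed.Build V submod_pred
  (GRing.subsemimod_closedB (GRing.subsemimodClosedP N)).

Definition quotmod : Type := Quotient.quot submod_pred.
HB.instance Definition _ := GRing.Zmodule.on quotmod.

Definition quotmod_pi (x : V) : quotmod := \pi_(Quotient.quot submod_pred) x.
Definition quotmod_scale (a : R) (x : quotmod) : quotmod :=
  quotmod_pi (a *: repr (x : Quotient.quot submod_pred)).

Lemma quotmod_piP (x : quotmod) : exists y, x = quotmod_pi y.
Proof. by exists (repr (x : Quotient.quot submod_pred)); rewrite /quotmod_pi reprK. Qed.

Lemma quotmod_pi_eq (x y : V) : (quotmod_pi x == quotmod_pi y) = (x - y \in N).
Proof. by rewrite -[RHS]/(x - y \in submod_pred) Quotient.idealrBE. Qed.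

Lemma quotmod_piD (x y : V) :
  quotmod_pi (x + y) = quotmod_pi x + quotmod_pi y.
Proof. exact: (raddfD \pi_(Quotient.quot submod_pred)). Qed.

Lemma quotmod_scale_pi (a : R) (x : V) :
  quotmod_scale a (quotmod_pi x) = quotmod_pi (a *: x).
Proof.
apply/eqP; rewrite quotmod_pi_eq -scalerBr rpredZ //.
by rewrite -quotmod_pi_eq /quotmod_pi reprK.
Qed.

Fact quotmod_scaleA a b x :
  quotmod_scale a (quotmod_scale b x) = quotmod_scale (a * b) x.
Proof. by have [y ->] := quotmod_piP x; rewrite !quotmod_scale_pi scalerA. Qed.

Fact quotmod_scale1 : left_id 1 quotmod_scale.
Proof. by move=> x; have [y ->] := quotmod_piP x; rewrite quotmod_scale_pi scale1r. Qed.

Fact quotmod_scaleDr : right_distributive quotmod_scale +%R.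
Proof.
move=> a x x'; have [y ->] := quotmod_piP x; have [y' ->] := quotmod_piP x'.
by rewrite -quotmod_piD !quotmod_scale_pi -quotmod_piD scalerDr.
Qed.

Fact quotmod_scaleDl x : {morph quotmod_scale^~ x : a b / a + b}.
Proof.
move=> a b; have [y ->] := quotmod_piP x.
by rewrite !quotmod_scale_pi -quotmod_piD scalerDl.
Qed.

HB.instance Definition _ := GRing.Zmodule_isLmodule.Build R quotmod
  quotmod_scaleA quotmod_scale1 quotmod_scaleDr quotmod_scaleDl.

End QuotientModule.

(* As multiplication of integers is commutative,
   the right action [ma] is written [a *: m]. *)
Section WeaklyMorphic.
Variable M : lmodType int.

Section Scalar.
Variable a : int.

Definition multiples : {pred M} := fun x => `[< exists m : M, x = a *: m >].

Fact multiples_submod_closed : submod_closed multiples.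
Proof.
split; first by apply/asboolP; exists 0; rewrite scaler0.
move=> c x y /asboolP[m ->] /asboolP[n ->]; apply/asboolP; exists (c *: m + n).
by rewrite scalerDr !scalerA mulrC.
Qed.
HB.instance Definition _ :=
  GRing.isSubmodClosed.Build int M multiples multiples_submod_closed.

Definition annihilated : {pred M} := fun m => a *: m == 0.

Fact annihilated_submod_closed : submod_closed annihilated.
Proof.
split; first by rewrite unfold_in /annihilated scaler0.
move=> c x y /eqP ax0 /eqP ay0; apply/eqP.
by rewrite scalerDr scalerA mulrC -scalerA ax0 ay0 scaler0 addr0.
Qed.
HB.instance Definition _ :=
  GRing.isSubmodClosed.Build int M annihilated annihilated_submod_closed.

Definition annihilator : Type := {m : M | annihilated m}.
HB.instance Definition _ := SubChoice.on annihilator.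
HB.instance Definition _ := [SubChoice_isSubLmodule of annihilator by <:].

End Scalar.

Definition weakly_morphic : Prop :=
  forall a : int,
    exists f : {linear quotmod (multiples a) -> annihilator a}, bijective f.

Definition finitely_generated : Prop :=
  exists (n : nat) (g : 'I_n -> M), forall m : M,
    exists c : 'I_n -> int, m = \sum_(i < n) c i *: g i.

End WeaklyMorphic.

(* Main.v *)
Require Import Defs.
From HB Require Import structures.
From mathcomp Require Import all_boot all_order all_algebra.
From mathcomp Require Import fingroup gproduct cyclic abelian.
From mathcomp Require Import boolp classical_sets functions cardinality.

(** Let [M] be generated by [g_1, ..., g_n].

    Suppose first that [M] is weakly-morphic. The torsion of a finitely
    generated [Z]-module is killed by a single nonzero [k]
    ([torsion_bounded]). Put [e = 2k]. The annihilator of [e^2] is torsion, so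
    [e] kills it; being isomorphic to it, [M / e^2 M] is killed by [e] too,
    which means [eM = e^2 M]. Hence [e g_i = e^2 m_i], and writing each [m_i]
    on the generators gives [e (1 - e C) g = 0] for an integer matrix [C]. By
    the determinant trick ([det_annihilates]), [e^n det (1 - e C)] kills [M].
    As [e] is even, this determinant is odd ([det_1_sub_2_neq0]), so a nonzero
    integer kills the finitely generated module [M], which is thus finite
    ([finite_fg_bounded]).

    Conversely a finite [M] is a direct sum of cyclic groups [<h_i>] of orders
    [d_i] ([cyclic_decomposition]). With [q_i = d_i / gcd(d_i, a)], the
    endomorphism of [M] sending each [h_i] to [q_i h_i] has kernel [aM] and
    image the annihilator of [a], as one checks on each cyclic summand; it
    therefore induces an isomorphism from [M / aM] onto that annihilator
    ([quotient_iso_annihilator]). *)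

Set Implicit Arguments.
Unset Strict Implicit.
Unset Printing Implicit Defensive.

Import Order.TTheory GRing.Theory Num.Theory.
Local Open Scope ring_scope.

(** * Quotients and scalars *)

Lemma quotmod_piZ (R : pzRingType) (V : lmodType R) (N : submodClosed V)
    (a : R) (x : V) :
  quotmod_pi N (a *: x) = a *: (quotmod_pi N x : quotmod N).
Proof. by rewrite -quotmod_scale_pi. Qed.

Lemma quotmod_pi0 (R : pzRingType) (V : lmodType R) (N : submodClosed V) :
  quotmod_pi N 0 = 0 :> quotmod N.
Proof. by rewrite -[X in quotmod_pi N X](scale0r 0) quotmod_piZ scale0r. Qed.

(** Being an [int]-module is no extra structure on an additive group, so facts
    about groups transfer to modules. *)
Lemma scalezE (M : lmodType int) (a : int) (x : M) : a *: x = x *~ a.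
Proof. by rewrite -scaler_int intz. Qed.

(** * Finitely generated weakly-morphic modules are finite *)

(** By induction on the number of generators. If a nonzero multiple [b g_0] of
    the first generator lies in the span of the others, multiplication by [b]
    brings every torsion element into that span. Otherwise the [g_0]
    coefficient of a torsion element vanishes, so the element lies in that span
    already. *)
Lemma torsion_bounded (M : lmodType int) (n : nat) (g : 'I_n -> M) :
  exists2 k : int, k != 0 &
    forall (c : 'I_n -> int) (m : int), m != 0 ->
      m *: (\sum_(i < n) c i *: g i) = 0 -> k *: (\sum_(i < n) c i *: g i) = 0.
Proof.
elim: n g => [|n IHn] g.
  by exists 1 => // c m _ _; rewrite big_ord0 scaler0.
have [k k0 Hk] := IHn (fun i => g (lift ord0 i)).
have [[b [b0 [s Hb]]]|indep] := pselect (exists b : int, b != 0 /\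
    exists s : 'I_n -> int, b *: g ord0 = \sum_(i < n) s i *: g (lift ord0 i)).
  exists (k * b); first by rewrite mulf_neq0.
  move=> c m m0; set x := \sum_(i < n.+1) _ => mx.
  have bx : b *: x =
      \sum_(i < n) (c ord0 * s i + b * c (lift ord0 i)) *: g (lift ord0 i).
    rewrite /x big_ord_recl scalerDr scalerA mulrC -scalerA Hb !scaler_sumr.
    by rewrite -big_split; apply: eq_bigr => i _; rewrite /= !scalerA scalerDl.
  rewrite -scalerA bx; apply: (Hk _ _ m0).
  by rewrite -bx scalerA mulrC -scalerA mx scaler0.
exists k => // c m m0 mx.
suff c0 : c ord0 = 0.
  by move: mx; rewrite !big_ord_recl c0 scale0r add0r; apply: Hk.
apply/eqP/negP => /negP c0; apply: indep; exists (m * c ord0).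
rewrite mulf_neq0 //; split => //; exists (fun i => - m * c (lift ord0 i)).
move: mx; rewrite big_ord_recl scalerDr scalerA scaler_sumr => /eqP.
rewrite addr_eq0 => /eqP ->; rewrite -sumrN; apply: eq_bigr => i _.
by rewrite scalerA mulNr scaleNr.
Qed.

(** Multiply the relations by the adjugate of [A]. *)
Lemma det_annihilates (M : lmodType int) (n : nat) (g : 'I_n -> M)
    (A : 'M[int]_n) :
  (forall i, \sum_(j < n) A i j *: g j = 0) -> forall i, \det A *: g i = 0.
Proof.
move=> Ag i.
have -> : \det A *: g i = \sum_(j < n) (\adj A *m A) i j *: g j.
  rewrite mul_adj_mx (bigD1 i) //= big1 ?addr0 ?mxE ?eqxx ?mulr1n //.
  by move=> j /negPf ji; rewrite mxE eq_sym ji mulr0n scale0r.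
under eq_bigr => j _ do rewrite mxE scaler_suml.
rewrite exchange_big big1 //= => k _.
under eq_bigr => j _ do rewrite -scalerA.
by rewrite -scaler_sumr Ag scaler0.
Qed.

(** The matrix is the identity modulo 2, so its determinant is odd. *)
Lemma det_1_sub_2_neq0 (n : nat) (A : 'M[int]_n) :
  \det (1%:M - 2 *: A) != 0.
Proof.
apply: contraTneq (oner_neq0 'F_2) => det0; rewrite negbK.
have := det_map_mx (intr : int -> 'F_2) (1%:M - 2 *: A).
rewrite det0 rmorph0 map_mxB map_mxZ map_mx1.
rewrite [X in X *: _](_ : _ = 0) ?scale0r ?subr0 ?det1 => [->//|].
exact/eqP.
Qed.

(** The coefficients on the generators only matter modulo [d], which leaves
    finitely many linear combinations. *)
Lemma finite_fg_bounded (M : lmodType int) (n : nat) (g : 'I_n -> M) (d : int) :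
  (forall m : M, exists c : 'I_n -> int, m = \sum_(i < n) c i *: g i) ->
  d != 0 -> (forall i, d *: g i = 0) -> finite_set [set: M]%classic.
Proof.
move=> gen d0 dg.
(* Residues are below [`|d|]; the successor is there for [inord]. *)
pose F (c : {ffun 'I_n -> 'I_`|d|.+1}) := \sum_(i < n) (c i)%:Z *: g i.
have -> : [set: M]%classic = [set F c | c in setT]%classic; last first.
  exact/finite_image/finite_finset.
apply/seteqP; split => // m _; have [c ->] := gen m.
exists [ffun i => inord `|(c i %% d)%Z|] => //.
apply: eq_bigr => i _; rewrite ffunE inordK; last first.
  by rewrite ltnS -lez_nat gez0_abs ?modz_ge0 // abszE ltW ?ltz_mod.
rewrite gez0_abs ?modz_ge0 // {2}(divz_eq (c i) d) scalerDl.
by rewrite -scalerA dg scaler0 add0r.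
Qed.

(** With [k] killing the torsion and [e = 2k], the isomorphism for the scalar
    [e^2] shows that [e] kills [M / e^2 M], that is, [eM = e^2 M]; the
    determinant trick then produces a nonzero integer killing [M]. *)
Lemma weakly_morphic_finite (M : lmodType int) :
  finitely_generated M -> weakly_morphic M -> finite_set [set: M]%classic.
Proof.
move=> [n [g gen]] wm.
have [k k0 Hk] := torsion_bounded g.
(* The factor 2 makes [1 - e C] the identity modulo 2, also when [k] is 1. *)
pose e := k * 2; have e0 : e != 0 by rewrite mulf_neq0.
have tors (m : M) : (e * e) *: m = 0 -> e *: m = 0.
  have [c ->] := gen m => mx; rewrite /e mulrC -scalerA.
  by rewrite (Hk c (e * e)) ?scaler0 ?mulf_neq0.
have [f /bij_inj f_inj] := wm (e * e).
(* [M / e^2 M] embeds in the annihilator of [e^2], which [e] kills. *)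
have esq (m : M) : exists m' : M, e *: m = (e * e) *: m'.
  suff : quotmod_pi (multiples (e * e)) (e *: m) == quotmod_pi _ 0.
    by rewrite quotmod_pi_eq subr0 => /asboolP.
  apply/eqP; apply: f_inj.
  rewrite quotmod_piZ quotmod_pi0 linearZ /=.
  rewrite linear0; set y := f _; apply: val_inj; rewrite linearZ /=.
  by apply: tors; apply/eqP; exact: (valP y).
have [m' Hm'] := choice (fun i => esq (g i)).
have [C HC] := choice (fun i => gen (m' i)).
pose A : 'M[int]_n := \matrix_(i, j) C i j.
(* [e g = e^2 C g] reads [e (1 - e C) g = 0], and [e C = 2 k C]. *)
have Ag := det_annihilates (g := g) (A := e *: (1%:M - 2 *: (k *: A))).
apply: (finite_fg_bounded gen _ (Ag _)).
  by rewrite detZ mulf_neq0 ?expf_neq0 ?det_1_sub_2_neq0.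
move=> i; under eq_bigr => j _ do rewrite !mxE mulrBr scalerBl.
rewrite sumrB (bigD1 i) //= big1 ?eqxx ?mulr1 ?addr0; last first.
  by move=> j /negPf ji; rewrite eq_sym ji mulr0 scale0r.
rewrite Hm' HC scaler_sumr; apply/eqP; rewrite subr_eq0; apply/eqP.
by apply: eq_bigr => j _; rewrite scalerA ?mxE /e -!mulrA (mulrCA k 2 (C i j)).
Qed.

(** * Finite modules are weakly-morphic *)

(** The structure theorem for finite abelian groups, in additive notation. *)
Lemma finZmod_cyclic_decomposition (V : finZmodType) :
  exists (n : nat) (h : 'I_n -> V) (d : 'I_n -> int),
    [/\ forall i, d i != 0,
        forall i c, h i *~ c = 0 <-> (d i %| c)%Z,
        forall x, exists c : 'I_n -> int, x = \sum_(i < n) h i *~ c i &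
        forall c : 'I_n -> int, \sum_(i < n) h i *~ c i = 0 ->
          forall i, h i *~ c i = 0].
Proof.
have [b defG _] := abelian_structure (FinRing.zmod_abelian [set: V]).
pose h (i : 'I_(size b)) : V := tnth (in_tuple b) i.
have {}defG : \big[dprod/1%g]_(i < size b) <[h i]>%g = [set: V]%g.
  by rewrite -defG (big_tnth _ _ b).
have cyc_mulz (i : 'I_(size b)) (c : int) : h i *~ c \in <[h i]>%g.
  case: c => c; first exact: mem_cycle.
  by rewrite NegzE mulrNz; apply/groupVr; exact: mem_cycle.
have ord_mulz i (c : int) : h i *~ c = 0 <-> ((#[h i]%g : int) %| c)%Z.
  rewrite dvdzE /= order_dvdn.
  case: c => c; first by split => [/eqP|/eqP].
  rewrite NegzE mulrNz abszN; split => [/eqP|/eqP c0].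
    by rewrite oppr_eq0.
  by apply/eqP; rewrite oppr_eq0; apply/eqP.
exists (size b), h, (fun i => #[h i]%g : int); split => //.
- by move=> i; rewrite -lt0n order_gt0.
- move=> x; have [c [cC -> _]] := mem_bigdprod defG (finset.in_setT x).
  have cE i : exists k : int, c i = h i *~ k.
    by have /cycleP[k ->] := cC i isT; exists k.
  have [k Hk] := choice cE; exists k.
  by apply: eq_bigr => i _; rewrite Hk.
- move=> c c0 i.
  have [c' [_ _ uniq0]] := mem_bigdprod defG (finset.in_setT (0 : V)).
  rewrite [LHS](uniq0 (fun i => h i *~ c i)) //.
  symmetry; apply: (uniq0 (fun=> 0)) => //; last by rewrite [RHS]big1.
  by move=> j _; exact: group1.
Qed.

(** Classically, a finite module carries an enumeration, hence the structure of
    a finite additive group, to which the structure theorem applies. *)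
Lemma cyclic_decomposition (M : lmodType int) :
  finite_set [set: M]%classic ->
  exists (n : nat) (h : 'I_n -> M) (d : 'I_n -> int),
    [/\ forall i, d i != 0,
        forall i c, c *: h i = 0 <-> (d i %| c)%Z,
        forall x, exists c : 'I_n -> int, x = \sum_(i < n) c i *: h i &
        forall c : 'I_n -> int, \sum_(i < n) c i *: h i = 0 ->
          forall i, c i *: h i = 0].
Proof.
move=> /finite_seqP[s0 Hs0]; pose s := undup s0.
have sP (x : M) : x \in s.
  by rewrite mem_undup; have : [set: M]%classic x by []; rewrite Hs0.
have s_ax : Finite.axiom s.
  by move=> x; rewrite count_uniq_mem ?undup_uniq // sP.
pose unp i : option M := if (i < size s)%N then Some (nth 0 s i) else None.
have idxK : pcancel (index^~ s) unp.
  by move=> x; rewrite /unp index_mem sP nth_index.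
(* [V] is [M] with the same addition, so sums in either agree by conversion. *)
pose V : finZmodType :=
  HB.pack M (Choice_isCountable.Build M idxK) (isFinite.Build M s_ax).
have [n [h [d [d0 ord_h span_h free_h]]]] := finZmod_cyclic_decomposition V.
have sumE (c : 'I_n -> int) :
    \sum_(i < n) c i *: (h i : M) = \sum_(i < n) h i *~ c i.
  by apply: eq_bigr => i _; rewrite scalezE.
exists n, h, d; split => //.
- by move=> i c; rewrite scalezE; exact: ord_h.
- by move=> x; have [c xE] := span_h x; exists c; rewrite sumE.
- by move=> c; rewrite sumE => c0 i; rewrite scalezE; exact: free_h.
Qed.

(** The first isomorphism theorem: it reduces the search for an isomorphism to
    that of an endomorphism of [M] with prescribed kernel and image. *)
Lemma quotient_iso_annihilator (M : lmodType int) (a : int)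
    (phi : {linear M -> M}) :
    (forall x, phi x = 0 <-> exists m : M, x = a *: m) ->
    (forall y : M, a *: y = 0 <-> exists x, y = phi x) ->
  exists f : {linear quotmod (@multiples M a) -> annihilator M a}, bijective f.
Proof.
move=> kerP imP; pose pi := quotmod_pi (@multiples M a).
have phi_ann x : annihilated a (phi x) by apply/eqP/imP; exists x.
have [rep repK] := choice (@quotmod_piP _ _ (@multiples M a)).
pose f (X : quotmod (@multiples M a)) : annihilator M a :=
  Sub (phi (rep X)) (phi_ann (rep X)).
have phi_eq x y : phi x = phi y <-> pi x = pi y.
  split => [phixy|/eqP]; last first.
    rewrite quotmod_pi_eq => /asboolP/kerP/eqP.
    by rewrite linearB subr_eq0 => /eqP.
  apply/eqP; rewrite quotmod_pi_eq; apply/asboolP/kerP.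
  by rewrite linearB phixy subrr.
have f_pi x : val (f (pi x)) = phi x.
  by rewrite SubK; apply/phi_eq; rewrite [RHS]repK.
have f_lin : linear f.
  move=> c X Y; rewrite (repK X) (repK Y).
  rewrite -quotmod_piZ -quotmod_piD; apply: val_inj.
  by rewrite [LHS]f_pi !linearP -!f_pi.
pose fL : {linear quotmod (@multiples M a) -> annihilator M a} :=
  HB.pack f (GRing.isLinear.Build int _ _ _ f f_lin).
exists fL.
have f_surj Y : exists X, f X = Y.
  have /imP[x Yx] : a *: val Y = 0 by apply/eqP; exact: valP Y.
  by exists (pi x); apply: val_inj; rewrite f_pi.
have [g fgK] := choice f_surj; exists g => //= X.
rewrite (repK X) (repK (g _)); apply/phi_eq.
by rewrite -!f_pi -[pi (rep (g _))]repK fgK.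
Qed.

(** In a cyclic group of order [d], multiplication by [q = d / gcd(d, a)] kills
    exactly the multiples of [gcd(d, a)], which are the multiples of [a]; its
    image consists of the multiples of [q], which are the elements killed by
    [a]. Directness of the sum lets this be done on all summands at once. *)
Lemma finite_weakly_morphic (M : lmodType int) :
  finite_set [set: M]%classic -> weakly_morphic M.
Proof.
move=> /cyclic_decomposition[n [h [d [d0 ord_h span_h free_h]]]] a.
pose q i := (d i %/ gcdz (d i) a)%Z.
have dq i : d i = q i * gcdz (d i) a by rewrite divzK ?dvdz_gcdl.
have q0 i : q i != 0.
  by apply: contraNneq (d0 i) => q0; rewrite dq q0 mul0r.
have g0 i : gcdz (d i) a != 0.
  by apply: contraNneq (d0 i) => g0; rewrite dq g0 mulr0.
have [coord coordK] := choice span_h.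
pose phi x := \sum_(i < n) (coord x i * q i) *: h i.
(* The choice of coordinates is immaterial: two choices for the same element
   differ by multiples of the orders of the [h i]. *)
have phiE c : phi (\sum_(i < n) c i *: h i) = \sum_(i < n) (c i * q i) *: h i.
  set x := \sum_(i < n) _.
  have cx : \sum_(i < n) (coord x i - c i) *: h i = 0.
    under eq_bigr => i _ do rewrite scalerBl.
    by rewrite sumrB -coordK subrr.
  apply: eq_bigr => i _; apply/eqP; rewrite -subr_eq0 -scalerBl -mulrBl.
  by rewrite mulrC -scalerA (free_h _ cx) scaler0.
have phi_lin : linear phi.
  move=> c x y; rewrite {1}(coordK x) {1}(coordK y) scaler_sumr -big_split /=.
  under eq_bigr => i _ do rewrite scalerA -scalerDl.
  rewrite phiE scaler_sumr -big_split; apply: eq_bigr => i _ /=.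
  by rewrite scalerA -scalerDl mulrDl mulrA.
have aq i : (d i %| a * q i)%Z.
  have /dvdzP[r {1}->] := dvdz_gcdr (d i) a.
  by rewrite -mulrA [_ * q i]mulrC -dq dvdz_mull.
pose phiL : {linear M -> M} :=
  HB.pack phi (GRing.isLinear.Build int M M _ phi phi_lin).
apply: (@quotient_iso_annihilator _ _ phiL) => [x|y]; split.
- rewrite (coordK x) [LHS]phiE => /free_h cq0.
  have cE i : exists u : int, coord x i *: h i = a *: (u *: h i).
    have /ord_h := cq0 i; rewrite {1}dq (mulrC (coord x i)) dvdz_mul2l //.
    move=> /dvdzP[r ->].
    (* [coord x i = r * gcdz (d i) a], and [gcdz (d i) a = u * d i + v * a]
       where [d i] kills [h i]. *)
    have [u [v <-]] := Bezoutz (d i) a; exists (r * v).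
    rewrite mulrDr scalerDl [X in X + _](_ : _ = 0) ?add0r.
      by rewrite scalerA mulrA mulrC.
    by apply/ord_h; rewrite mulrA dvdz_mull.
  have [u uE] := choice cE; exists (\sum_(i < n) u i *: h i).
  by rewrite scaler_sumr; apply: eq_bigr => i _; rewrite uE.
- move=> [m ->]; rewrite linearZ /= /phi scaler_sumr big1 // => i _.
  rewrite scalerA; apply/ord_h.
  by rewrite mulrCA dvdz_mull.
- rewrite {1}(coordK y) scaler_sumr => ay0.
  have ac i : (a * coord y i) *: h i = 0.
    apply: (free_h (fun i => a * coord y i)).
    by under eq_bigr => j _ do rewrite -scalerA.
  have qc i : exists r, coord y i = r * q i.
    apply/dvdzP; rewrite -(@dvdz_mul2r (gcdz (d i) a)) ?g0 // -dq.
    (* Now [d i] must divide [coord y i * gcdz (d i) a]; it divides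
       [a * coord y i]. *)
    have [u [v <-]] := Bezoutz (d i) a; rewrite mulrDr.
    apply: rpredD; first by rewrite mulrA dvdz_mull.
    by rewrite mulrCA (mulrC _ a) dvdz_mull //; apply/ord_h.
  have [r rE] := choice qc; exists (\sum_(i < n) r i *: h i).
  by rewrite /= phiE [LHS]coordK; apply: eq_bigr => i _; rewrite rE.
- move=> [x ->]; rewrite /= /phi scaler_sumr big1 // => i _.
  by rewrite scalerA; apply/ord_h; rewrite mulrCA dvdz_mull.
Qed.

Theorem theorem5 (M : lmodType int) (hfg : finitely_generated M) :
  weakly_morphic M <-> finite_set [set: M]%classic.
Proof.
by split; [exact: weakly_morphic_finite | exact: finite_weakly_morphic].
Qed.
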